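(* Let $n\ge m\ge1$. An entrywise nonnegative $m\times n$ matrix $A$ satisfies $$\|A\|_{S_1}=\frac{\left(m+\sqrt{m}\right)\sqrt{n}}{2}|A|_\infty$$ if and only if the matrix $2A-J_{m,n}$ is plain and belongs to $\mathsf{Had}_{m,n}$.
   Context: For an $m\times n$ complex matrix $A=[a_{ij}]$, $\sigma_1(A)\ge\cdots\ge\sigma_m(A)$ are its singular values (square roots of the eigenvalues of $AA^*$, where $A^*$ is the Hermitian adjoint of $A$), $\|A\|_{S_1}=\sigma_1(A)+\cdots+\sigma_m(A)$, and $|A|_\infty=\max_{i,j}|a_{ij}|$. $J_{m,n}$ is the $m\times n$ all-ones matrix. $\mathsf{Had}_{m,n}$ is the class of complex $m\times n$ matrices whose entries all have the same modulus and whose rows are pairwise orthogonal (for $m=1$ the orthogonality condition is vacuous). An $m\times n$ matrix $B$ is called plain if the all-ones vectors $\mathbf{j}_m\in\mathbb{R}^m$ and $\mathbf{j}_n\in\mathbb{R}^n$ are singular vectors to $\sigma_1(B)$, that is, $\sigma_1(B)=\langle \mathbf{j}_m,B\mathbf{j}_n\rangle/\sqrt{mn}$.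
   Formalization: As printed the claim fails unless |A|_∞=1 (e.g. A=0, m=n=1, where 2A−J is not plain); it is proved as printed when |A|_∞=1, and for every nonnegative A with 2A−J_{m,n} replaced by 2A−|A|_∞J_{m,n}. *)

(* Defs.v *)
From mathcomp Require Export all_boot all_order all_algebra.
From mathcomp Require Export sesquilinear spectral complex.
From mathcomp Require Export reals matrix_normedtype.

Set Implicit Arguments.
Unset Strict Implicit.
Unset Printing Implicit Defensive.

Import Order.TTheory GRing.Theory Num.Theory.
Local Open Scope ring_scope.
Local Open Scope sesquilinear_scope.

(* The values below live in C itself, where 0 <= z means that z is a nonnegative
   real. The norm |A|_oo is mx_norm A; the Hermitian adjoint A^* is A ^t*. *)

Section Defs.
Context {C : numClosedFieldType}.

(* the roots of the characteristic polynomial, with multiplicity (in no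
   specified order) *)
Definition eigenvals n (M : 'M[C]_n) : seq C :=
  sval (closed_field_poly_normal (char_poly M)).

Lemma char_poly_eigenvals n (M : 'M[C]_n) :
  char_poly M = \prod_(z <- eigenvals M) ('X - z%:P).
Proof.
rewrite /eigenvals; case: closed_field_poly_normal => r /= ->.
by rewrite (monicP (char_poly_monic M)) scale1r.
Qed.

(* Eigenvalues of A A^* are nonnegative reals, so their square roots are
   pairwise comparable and the sort is nonincreasing. *)
Definition singular_values m n (A : 'M[C]_(m, n)) : seq C :=
  sort >=%R [seq sqrtC z | z <- eigenvals (A *m A ^t*)].

Lemma size_singular_values m n (A : 'M[C]_(m, n)) :
  size (singular_values A) = m.
Proof.
rewrite size_sort size_map; apply: succn_inj.
by rewrite -(size_char_poly (A *m A ^t*)) char_poly_eigenvals size_prod_XsubC.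
Qed.

(* numbered from 0: [sigma A 0] is the largest singular value *)
Definition sigma m n (A : 'M[C]_(m, n)) (k : nat) : C :=
  (singular_values A)`_k.

Definition schatten1 m n (A : 'M[C]_(m, n)) : C := \sum_(k < m) sigma A k.

Definition allones m n : 'M[C]_(m, n) := const_mx 1.

Definition Had m n (A : 'M[C]_(m, n)) : Prop :=
  (forall i j i' j', `|A i j| = `|A i' j'|) /\
  (forall i i', i != i' -> dotmx (row i A) (row i' A) = 0).

(* dotmx takes row vectors, whence the transposes of the columns j_m, B j_n. *)
Definition plain m n (B : 'M[C]_(m, n)) : Prop :=
  sigma B 0 =
  dotmx (allones m 1)^T (B *m allones n 1)^T / sqrtC (m * n)%:R.

End Defs.

Arguments allones {C} m n.

(* Main.v *)
(* Let t = |A|_oo, B = 2A - tJ and c = t sqrt n; the entries of B lie in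
   [-t, t]. Trace duality for the Schatten norm provides a contraction V with
   <A, V> = ||A||_1, where <X, Y> = tr (X Y^* ), and then
     2c ( c (m + sqrt m) - 2 ||A||_1 ) =
       ||B - cV||^2 + (c^2 m - ||B||^2) + c^2 (m - ||V||^2)
         + 2ct (sqrt (mn) - Re <J, V>)
   in Frobenius norms, all four terms being nonnegative. Equality forces
   B = cV, V V^* = 1, |b_ij| = t and <J, B> = c sqrt (mn), that is, B is plain
   and in Had. Conversely, for such a B the matrix V = B / c is a coisometry and
   Re <A, V> <= ||A||_1 is the reverse inequality. *)
Require Import Defs.
From mathcomp Require Import all_boot all_order all_algebra.
From mathcomp Require Import complex reals interval_inference matrix_normedtype.
From mathcomp Require Import ring.

Import Order.TTheory GRing.Theory Num.Theory.
Local Open Scope ring_scope.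
Local Open Scope sesquilinear_scope.

Section HilbertSchmidt.
Set Implicit Arguments.
Unset Strict Implicit.
Context {C : numClosedFieldType}.

(** * The Frobenius inner product *)

Definition hsdot m n (A B : 'M[C]_(m, n)) : C := \tr (A *m B ^t*).

Lemma adjmxM m n p (A : 'M[C]_(m, n)) (B : 'M_(n, p)) :
  (A *m B) ^t* = B ^t* *m A ^t*.
Proof. by rewrite trmx_mul map_mxM. Qed.

Lemma hsdotE m n (A B : 'M[C]_(m, n)) :
  hsdot A B = \sum_i \sum_j A i j * (B i j)^*.
Proof.
rewrite /hsdot /mxtrace; apply: eq_bigr => i _.
by rewrite !mxE; apply: eq_bigr => j _; rewrite !mxE.
Qed.

Lemma hsdotC m n (A B : 'M[C]_(m, n)) : hsdot B A = (hsdot A B)^*.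
Proof.
rewrite !hsdotE rmorph_sum; apply: eq_bigr => i _.
rewrite rmorph_sum; apply: eq_bigr => j _.
by rewrite rmorphM /= conjCK mulrC.
Qed.

Lemma hsdotDl m n (A B D : 'M[C]_(m, n)) :
  hsdot (A + B) D = hsdot A D + hsdot B D.
Proof. by rewrite /hsdot mulmxDl linearD. Qed.

Lemma hsdotZl m n (c : C) (A B : 'M[C]_(m, n)) :
  hsdot (c *: A) B = c * hsdot A B.
Proof. by rewrite /hsdot -scalemxAl linearZ. Qed.

Lemma hsdotDr m n (A B D : 'M[C]_(m, n)) :
  hsdot D (A + B) = hsdot D A + hsdot D B.
Proof. by rewrite hsdotC hsdotDl rmorphD /= -!hsdotC. Qed.

Lemma hsdotZr m n (c : C) (A B : 'M[C]_(m, n)) :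
  hsdot A (c *: B) = c^* * hsdot A B.
Proof. by rewrite hsdotC hsdotZl rmorphM /= -hsdotC. Qed.

Lemma hsdot_norm m n (A : 'M[C]_(m, n)) :
  hsdot A A = \sum_i \sum_j `|A i j| ^+ 2.
Proof.
rewrite hsdotE; apply: eq_bigr => i _; apply: eq_bigr => j _.
by rewrite normCK.
Qed.

Lemma hsdot_ge0 m n (A : 'M[C]_(m, n)) : 0 <= hsdot A A.
Proof.
rewrite hsdot_norm; apply: sumr_ge0 => i _; apply: sumr_ge0 => j _.
exact: exprn_ge0.
Qed.

Lemma hsdot_eq0 m n (A : 'M[C]_(m, n)) : hsdot A A = 0 -> A = 0.
Proof.
rewrite hsdot_norm => A0; apply/matrixP=> i j; rewrite mxE.
have ge0 i' : 0 <= \sum_j `|A i' j| ^+ 2.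
  by apply: sumr_ge0 => k _; apply: exprn_ge0.
have Ai0 := psumr_eq0P (fun i' _ => ge0 i') A0 (i := i) isT.
have /eqP := psumr_eq0P (fun k _ => exprn_ge0 2 (normr_ge0 (A i k))) Ai0
  (i := j) isT.
by rewrite sqrf_eq0 normr_eq0 => /eqP.
Qed.

Lemma hsdotBZ m n (c : C) (A B : 'M[C]_(m, n)) : 0 <= c ->
  hsdot (A - c *: B) (A - c *: B) =
  hsdot A A - c * (hsdot A B + hsdot B A)
    + c ^+ 2 * hsdot B B.
Proof.
move=> c0; have cr : c^* = c by apply/CrealP/ger0_real.
rewrite -scaleNr !(hsdotDl, hsdotDr, hsdotZl, hsdotZr) rmorphN /= cr; ring.
Qed.

Lemma hsdot_row m n (A B : 'M[C]_(m, n)) i :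
  hsdot (row i A) (row i B) = (A *m B ^t*) i i.
Proof.
rewrite hsdotE big_ord1 mxE; apply: eq_bigr => j _.
by rewrite !mxE.
Qed.

Lemma hsdot_unitaryl m n (U : 'M[C]_m) (A B : 'M_(m, n)) :
  U \is unitarymx -> hsdot (U *m A) (U *m B) = hsdot A B.
Proof.
move=> Uu; rewrite /hsdot adjmxM mulmxA mxtrace_mulC !mulmxA.
by rewrite -[U ^t* *m U]mul1mx mulmxA mulmxKtV ?mul1mx.
Qed.

(** For a rectangular V, [unitarymx] means V V^* = 1, that is, orthonormal rows; this is the factor
    that cancels inside the trace. *)
Lemma hsdot_unitaryr m n p (V : 'M[C]_(n, p)) (A B : 'M_(m, n)) :
  V \is unitarymx -> hsdot (A *m V) (B *m V) = hsdot A B.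
Proof. by move=> Vu; rewrite /hsdot adjmxM mulmxA mulmxtVK. Qed.

(** * Diagonalization of A A^* and singular values *)

Lemma char_poly_invmx_conj n (P D : 'M[C]_n) : P \in unitmx ->
  char_poly (invmx P *m D *m P) = char_poly D.
Proof.
move=> Pu; rewrite /char_poly /char_poly_mx.
have -> : 'X%:M - map_mx polyC (invmx P *m D *m P) =
    map_mx polyC (invmx P) *m ('X%:M - map_mx polyC D) *m map_mx polyC P.
  rewrite mulmxBr mulmxBl !map_mxM; congr (_ - _).
  by rewrite mul_mx_scalar -scalemxAl -map_mxM mulVmx // map_mx1 scalemx1.
rewrite !det_mulmx mulrAC -det_mulmx -map_mxM mulVmx // map_mx1.
by rewrite det1 mul1r.
Qed.

Lemma schatten1E m n (A : 'M[C]_(m, n)) :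
  schatten1 A = \sum_(z <- eigenvals (A *m A ^t*)) sqrtC z.
Proof.
have -> : schatten1 A = \sum_(x <- singular_values A) x.
  by rewrite (big_nth 0) size_singular_values big_mkord.
by rewrite (perm_big _ (permEl (perm_sort _ _))) big_map.
Qed.

(** Half of a singular value decomposition, from the spectral theorem for A A^*: the rows of U A are
    pairwise orthogonal with lengths [s i]. The [s i] come unsorted, which their sum does not
    see. *)
Lemma schatten1_diag m n (A : 'M[C]_(m, n)) :
  exists U : 'M[C]_m, exists s : 'I_m -> C,
  [/\ U \is unitarymx, forall i, 0 <= s i,
      (U *m A) *m (U *m A) ^t* = diag_mx (\row_i s i ^+ 2)
    & schatten1 A = \sum_i s i].
Proof.
pose M := A *m A ^t*.
have adjM : M ^t* = M by rewrite adjmxM trmxCK.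
have Mn : M \is normalmx by apply/normalmxP; rewrite adjM.
have := orthomx_spectralP Mn; cbv zeta.
set P := spectralmx M; set d := spectral_diag M => defM.
have Pu : P \is unitarymx by apply: spectral_unitarymx.
have Pi := unitarymx_unit Pu.
have PAE : (P *m A) *m (P *m A) ^t* = diag_mx d.
  rewrite adjmxM mulmxA -(mulmxA P) -/M defM !mulmxA mulmxtVK //.
  by rewrite mulmxV // mul1mx.
(* [d 0 i] is the squared length of row i of P A. *)
have d0 i : 0 <= d 0 i.
  have := hsdot_ge0 (row i (P *m A)).
  by rewrite hsdot_row PAE !mxE eqxx.
exists P, (fun i => sqrtC (d 0 i)); split=> //.
- by move=> i; rewrite sqrtC_ge0.
- by rewrite PAE; congr diag_mx; apply/rowP=> i; rewrite mxE sqrtCK.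
rewrite schatten1E -/M.
have -> : \sum_i sqrtC (d 0 i) =
    \sum_(z <- [seq d 0 i | i <- enum 'I_m]) sqrtC z.
  by rewrite big_map big_enum.
(* Two factorizations of one characteristic polynomial into linear factors have the same roots up to
   order. *)
apply: perm_big; apply: prod_XsubC_eq.
rewrite -char_poly_eigenvals defM char_poly_invmx_conj //.
rewrite char_poly_trig ?diag_mx_is_trig // big_map big_enum /=.
by apply: eq_bigr => i _; rewrite mxE eqxx.
Qed.

(** Every eigenvalue of a scalar matrix is that scalar, and [0 <= c] makes c the chosen root of
    c^2. *)
Lemma singular_values_scalar m n (A : 'M[C]_(m, n)) (c : C) : 0 <= c ->
  A *m A ^t* = (c ^+ 2)%:M -> singular_values A = nseq m c.
Proof.
move=> c0 AA; suff: all (pred1 c) (singular_values A).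
  by move/all_pred1P; rewrite size_singular_values.
rewrite /singular_values all_sort all_map.
apply/allP => z zin /=; apply/eqP.
have : root (char_poly (A *m A ^t*)) z.
  by rewrite char_poly_eigenvals root_prod_XsubC.
rewrite AA -eigenvalue_root_char => /eigenvalueP[v].
rewrite mul_mx_scalar => /eqP; rewrite -subr_eq0 -scalerBl scaler_eq0 subr_eq0.
by move=> /orP[/eqP<- _|/eqP-> /eqP//]; rewrite sqrCK.
Qed.

(** * Trace duality for the Schatten norm *)

(** V is the partial isometry of the polar decomposition of A. V V^* is an orthogonal projection,
    hence V is a contraction; the squared norm of V is the rank of A, and rank m makes the
    projection the identity. *)
Lemma schatten1_attained m n (A : 'M[C]_(m, n)) :
  exists V : 'M[C]_(m, n),
  [/\ hsdot A V = schatten1 A, hsdot V V <= m%:R,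
      hsdot V V = m%:R -> V \is unitarymx
    & forall u : 'rV_m, hsdot (u *m V) (u *m V) <= hsdot u u].
Proof.
have [U [s [Uu s0 UAE ->]]] := schatten1_diag A.
have UU : U ^t* *m U = 1%:M by rewrite -[LHS]mul1mx mulmxA mulmxKtV.
have U'u : U ^t* \is unitarymx by rewrite trmxC_unitary.
have sr i : (s i)^* = s i by apply/CrealP/ger0_real.
(* Since [0^-1 = 0], D is the pseudo-inverse of diag(s): it normalizes the nonzero rows of U A and
   leaves the others zero. *)
pose D : 'M[C]_m := diag_mx (\row_i (s i)^-1).
have adjD : D ^t* = D.
  apply/matrixP=> i j; rewrite !mxE eq_sym; case: eqP => [->|_] /=.
    by rewrite !mulr1n fmorphV /= sr.
  by rewrite !mulr0n rmorph0.
pose W := D *m (U *m A); pose b : 'rV[C]_m := \row_i (s i != 0)%:R.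
have WW : W *m W ^t* = diag_mx b.
  rewrite adjmxM mulmxA -(mulmxA D) UAE adjD -/D.
  rewrite !mulmx_diag; congr diag_mx; apply/rowP=> i; rewrite !mxE.
  case: eqVneq => [->|si]; first by rewrite invr0 !mul0r.
  by rewrite expr2 mulKf // divff.
have VV : hsdot (U ^t* *m W) (U ^t* *m W) = \sum_i b 0 i.
  by rewrite hsdot_unitaryl // /hsdot WW mxtrace_diag.
have b1 i : b 0 i <= 1 by rewrite mxE lern1 leq_b1.
exists (U ^t* *m W); split.
- rewrite -(hsdot_unitaryl _ _ Uu) mulmxA (unitarymxP Uu) mul1mx.
  rewrite /hsdot adjmxM mulmxA UAE adjD mulmx_diag mxtrace_diag.
  apply: eq_bigr => i _; rewrite !mxE.
  case: (eqVneq (s i) 0) => [->|si]; first by rewrite expr2 !mul0r.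
  by rewrite expr2 mulfK.
- have -> : m%:R = \sum_(i < m) (1 : C) by rewrite sumr_const card_ord.
  by rewrite VV; apply: ler_sum.
- rewrite VV => bm; apply/unitarymxP.
  (* m numbers that are at most 1 and add up to m are all equal to 1. *)
  have bE : b = const_mx 1.
    apply/rowP=> i; rewrite [RHS]mxE; apply/eqP.
    rewrite -subr_eq0 -oppr_eq0 opprB.
    apply/eqP; have ge0 k : 0 <= 1 - b 0 k by rewrite subr_ge0.
    have sum0 : \sum_k (1 - b 0 k) = 0.
      by rewrite sumrB sumr_const card_ord bm subrr.
    exact: (psumr_eq0P (fun k _ => ge0 k) sum0 (i := i)).
  rewrite adjmxM trmxCK mulmxA -(mulmxA _ W) WW bE diag_const_mx.
  by rewrite mulmx1.
(* In the coordinates w = u U^* the inequality is termwise, with weights b at most 1. *)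
move=> u; rewrite mulmxA.
rewrite -(hsdot_unitaryr u u U'u).
move: (u *m U ^t*) => w; rewrite /hsdot adjmxM mulmxA -(mulmxA w) WW.
rewrite !trace_mx11 !mxE; apply: ler_sum => i _; rewrite mul_mx_diag !mxE.
rewrite mulrAC.
by apply: ler_piMr; [apply: mul_conjC_ge0 | rewrite lern1 leq_b1].
Qed.

(** Cauchy-Schwarz row by row: after multiplication by U the rows of A have length [s i] and those
    of V length 1. *)
Lemma schatten1_ge m n (A V : 'M[C]_(m, n)) : V \is unitarymx ->
  hsdot A V + hsdot V A <= 2 * schatten1 A.
Proof.
move=> Vu; have [U [s [Uu s0 UAE ->]]] := schatten1_diag A.
have UVu := mul_unitarymx Uu Vu.
rewrite -(hsdot_unitaryl A V Uu) -(hsdot_unitaryl V A Uu).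
move: (U *m A) (U *m V) UAE UVu => X Y XX /unitarymxP YY.
rewrite {1 2}/hsdot -big_split mulr_sumr /=; apply: ler_sum => i _.
rewrite -!hsdot_row.
have rX : hsdot (row i X) (row i X) = s i ^+ 2.
  by rewrite hsdot_row XX !mxE eqxx.
have rY : hsdot (row i Y) (row i Y) = 1.
  by rewrite hsdot_row YY mxE eqxx.
(* The square expanded below yields the bound multiplied by [s i], so [s i = 0] is treated apart. *)
case: (eqVneq (s i) 0) => [si|si].
  rewrite [row i X]hsdot_eq0; last by rewrite rX si expr0n.
  by rewrite /hsdot mul0mx trmx0 map_mx0 mulmx0 mxtrace0 addr0 si mulr0.
have := hsdot_ge0 (row i X - s i *: row i Y).
rewrite hsdotBZ // rX rY mulr1.
set x := hsdot _ _ + _ => h.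
have {si}si : 0 < s i by rewrite lt_neqAle eq_sym si s0.
rewrite -(ler_pM2l si) -subr_ge0; move: h; congr (0 <= _); ring.
Qed.

(** * The all-ones matrix and the defect identity *)

Lemma hsdot_allones m n (B : 'M[C]_(m, n)) :
  hsdot (allones m n) B = \sum_i \sum_j (B i j)^*.
Proof.
rewrite hsdotE; apply: eq_bigr => i _; apply: eq_bigr => j _.
by rewrite mxE mul1r.
Qed.

Lemma hsdot_allones1 m n : hsdot (allones m n) (allones m n) = (m * n)%:R :> C.
Proof.
rewrite hsdot_allones (eq_bigr (fun=> n%:R)) => [|i _].
  by rewrite sumr_const card_ord mulnC mulrnA.
rewrite (eq_bigr (fun=> 1)) => [|j _]; first by rewrite sumr_const card_ord.
by rewrite mxE rmorph1.
Qed.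

(** J has rank one, so <V, J> is the product of the row j_m V with the row j_n. Cauchy-Schwarz
    applies, the contraction property bounding the length of j_m V by sqrt m. *)
Lemma hsdot_allones_le m n (V : 'M[C]_(m, n)) : (0 < m)%N -> (0 < n)%N ->
  (forall u : 'rV_m, hsdot (u *m V) (u *m V) <= hsdot u u) ->
  hsdot V (allones m n) + hsdot (allones m n) V
    <= 2 * (sqrtC m%:R * sqrtC n%:R).
Proof.
(* The factor d stretches j_n to length sqrt m, the bound for j_m V, so that expanding one square
   gives the sharp constant. *)
move=> m0 n0 Vc; pose d : C := sqrtC m%:R / sqrtC n%:R.
have sm0 : 0 < sqrtC m%:R :> C by rewrite sqrtC_gt0 ltr0n.
have sn0 : 0 < sqrtC n%:R :> C by rewrite sqrtC_gt0 ltr0n.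
have d0 : 0 < d by rewrite divr_gt0.
have jE : allones m n = (allones 1 m) ^t* *m allones 1 n :> 'M[C]_(m, n).
  by apply/matrixP=> i j; rewrite !mxE big_ord1 !mxE rmorph1 mulr1.
have jV : hsdot (allones 1 m *m V) (allones 1 n) = hsdot V (allones m n).
  by rewrite /hsdot jE adjmxM trmxCK -mulmxA mxtrace_mulC mulmxA.
have := hsdot_ge0 (allones 1 m *m V - d *: allones 1 n).
rewrite (hsdotBZ _ _ (ltW d0)) [hsdot (allones 1 n) (_ *m _)]hsdotC jV -hsdotC.
rewrite !hsdot_allones1 !mul1n => h.
have := Vc (allones 1 m); rewrite hsdot_allones1 mul1n -subr_ge0 => h'.
rewrite -(ler_pM2l d0) -subr_ge0; move: (addr_ge0 h h'); congr (0 <= _).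
have dn : d ^+ 2 * n%:R = m%:R.
  by rewrite expr_div_n !sqrtCK divfK // pnatr_eq0 -lt0n.
have dm : d * (2 * (sqrtC m%:R * sqrtC n%:R)) = 2 * m%:R.
  by rewrite -[in RHS](sqrtCK m%:R) /d; field; rewrite gt_eqF.
rewrite dn dm; ring.
Qed.

(* The sums with their conjugates stand for twice the real part. *)
Lemma schatten1_defect m n (A B : 'M[C]_(m, n)) t (c := t * sqrtC n%:R) :
  (0 < m)%N -> (0 < n)%N -> 0 <= t -> 2 *: A = B + t *: allones m n ->
  exists V : 'M[C]_(m, n),
  [/\ hsdot V V <= m%:R, hsdot V V = m%:R -> V \is unitarymx,
      hsdot V (allones m n) + hsdot (allones m n) V
        <= 2 * (sqrtC m%:R * sqrtC n%:R)
    & c * (2 * c * (m%:R + sqrtC m%:R) - 4 * schatten1 A) =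
      hsdot (B - c *: V) (B - c *: V) + (c ^+ 2 * m%:R - hsdot B B)
      + c ^+ 2 * (m%:R - hsdot V V)
      + c * t * (2 * (sqrtC m%:R * sqrtC n%:R)
                 - (hsdot V (allones m n) + hsdot (allones m n) V))].
Proof.
move=> m0 n0 t0 AB; have [V [AV Vm Vu Vc]] := schatten1_attained A.
exists V; split=> //; first exact: hsdot_allones_le.
have tr : t^* = t by apply/CrealP/ger0_real.
(* Both <A, V> and its conjugate equal the real number ||A||_1; substituting 2A = B + tJ then trades
   A for B and J. *)
have SE : 4 * schatten1 A = hsdot B V + hsdot V B
    + t * (hsdot V (allones m n) + hsdot (allones m n) V).
  have AV' : hsdot V A = schatten1 A.
    have [U [s [_ s0 _ SA]]] := schatten1_diag A.
    by rewrite hsdotC AV; apply/CrealP/ger0_real; rewrite SA; apply: sumr_ge0.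
  have -> : 4 * schatten1 A = hsdot (2 *: A) V + hsdot V (2 *: A).
    by rewrite hsdotZl hsdotZr AV AV' rmorph_nat; ring.
  rewrite AB !(hsdotDl, hsdotDr, hsdotZl, hsdotZr) tr; ring.
have c0 : 0 <= c by rewrite mulr_ge0 // sqrtC_ge0 ler0n.
(* Once the square is expanded, the terms in ||B||^2 and ||V||^2 cancel. *)
rewrite SE (hsdotBZ _ _ c0) /c; ring.
Qed.

(** * The equality case *)

Lemma plainE m n (B : 'M[C]_(m, n)) :
  plain B <-> sigma B 0 =
    hsdot (allones m n) B / (sqrtC m%:R * sqrtC n%:R).
Proof.
rewrite /plain natrM rootCMl ?ler0n //.
suff -> : dotmx (allones m 1)^T (B *m allones n 1)^T = hsdot (allones m n) B.
  by [].
rewrite dotmxE hsdot_allones mxE; apply: eq_bigr => i _.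
rewrite !mxE mul1r rmorph_sum; apply: eq_bigr => j _.
by rewrite !mxE mulr1.
Qed.

Lemma dotmx_row m n (B : 'M[C]_(m, n)) i j :
  dotmx (row i B) (row j B) = (B *m B ^t*) i j.
Proof.
by rewrite dotmxE mxE [RHS]mxE; apply: eq_bigr => k _; rewrite !mxE.
Qed.

(** [0 < m] puts index 0 inside the list; on an empty list [sigma B 0] would be the default value
    0. *)
Lemma sigma0_scalar m n (B : 'M[C]_(m, n)) c : (0 < m)%N -> 0 <= c ->
  B *m B ^t* = (c ^+ 2)%:M -> sigma B 0 = c.
Proof.
by case: m B => // m B _ c0 BB; rewrite /sigma (singular_values_scalar c0 BB).
Qed.

(** The max norm enters only as a bound t on the entries that some entry attains. *)
Lemma schatten1_extremal m n (A : 'M[C]_(m, n)) t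
    (B := 2 *: A - t *: allones m n) :
  (0 < m)%N -> (0 < n)%N -> 0 < t ->
  (forall i j, 0 <= A i j <= t) -> (exists i j, A i j = t) ->
  schatten1 A = (m%:R + sqrtC m%:R) * sqrtC n%:R / 2 * t <->
  plain B /\ Had B.
Proof.
move=> m0 n0 t0 Ab [i0 [j0 Aij0]].
have sm0 : 0 < sqrtC m%:R :> C by rewrite sqrtC_gt0 ltr0n.
have sn0 : 0 < sqrtC n%:R :> C by rewrite sqrtC_gt0 ltr0n.
pose c := t * sqrtC n%:R; have c0 : 0 < c by rewrite mulr_gt0.
have cr : c^* = c by apply/CrealP/ger0_real/ltW.
have tr : t^* = t by apply/CrealP/ger0_real/ltW.
have c2 : c ^+ 2 = t ^+ 2 * n%:R by rewrite exprMn sqrtCK.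
have BE i j : B i j = 2 * A i j - t by rewrite !mxE mulr1.
have ABt : 2 *: A = B + t *: allones m n by rewrite subrK.
clearbody B.
have Br i j : (B i j)^* = B i j.
  have /andP[A0 _] := Ab i j.
  rewrite BE rmorphB rmorphM rmorph_nat /= tr.
  by have /CrealP -> : A i j \is Num.real by apply: ger0_real.
have Bt i j : `|B i j| <= t.
  have /andP[A0 At] := Ab i j.
  have Breal : B i j \is Num.real by apply/CrealP.
  rewrite real_ler_norml // BE; apply/andP; split.
    by rewrite lerBrDr addNr mulr_ge0 ?ler0n.
  have tt : t + t = 2 * t by ring.
  by rewrite lerBlDr tt ler_pM2l ?ltr0n.
have Bt2 i j : 0 <= t ^+ 2 - `|B i j| ^+ 2.
  by rewrite subr_ge0 lerXn2r // ?nnegrE ?normr_ge0 // ltW.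
(* As c^2 m = m n t^2, this deficit distributes over the entries, so its vanishing forces every
   |b_ij| = t. *)
have sumB : c ^+ 2 * m%:R - hsdot B B = \sum_i \sum_j (t ^+ 2 - `|B i j| ^+ 2).
  rewrite hsdot_norm; under [RHS]eq_bigr do rewrite sumrB sumr_const card_ord.
  by rewrite sumrB sumr_const card_ord c2 !mulr_natr.
have [V [Vm Vu VJ defect]] := schatten1_defect m0 n0 (ltW t0) ABt.
have h1 := hsdot_ge0 (B - c *: V).
have sumB0 i : 0 <= \sum_j (t ^+ 2 - `|B i j| ^+ 2) by apply: sumr_ge0.
have h2 : 0 <= c ^+ 2 * m%:R - hsdot B B by rewrite sumB; apply: sumr_ge0.
have h3 : 0 <= c ^+ 2 * (m%:R - hsdot V V).
  by rewrite mulr_ge0 ?subr_ge0 // exprn_ge0 ?ltW.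
have h4 : 0 <= c * t * (2 * (sqrtC m%:R * sqrtC n%:R)
      - (hsdot V (allones m n) + hsdot (allones m n) V)).
  by rewrite mulr_ge0 ?subr_ge0 // mulr_ge0 ?ltW.
rewrite -/c in defect.
have two0 : (2 : C) != 0 by rewrite pnatr_eq0.
have targetE : 4 * ((m%:R + sqrtC m%:R) * sqrtC n%:R / 2 * t) =
    2 * c * (m%:R + sqrtC m%:R) by rewrite /c; field.
split=> [SE|[/plainE Bplain [Bmod Borth]]].
  move/eqP: defect; rewrite SE targetE subrr mulr0 eq_sym.
  (* The defect is 0, hence so is each of its four nonnegative terms: [d1] gives B = cV, [d2] the
     moduli, [d3] the coisometry, [d4] the value of <J, B>. *)
  rewrite (paddr_eq0 (addr_ge0 (addr_ge0 h1 h2) h3) h4).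
  rewrite (paddr_eq0 (addr_ge0 h1 h2) h3) (paddr_eq0 h1 h2).
  move=> /andP[/andP[/andP[d1 d2] d3] d4].
  have BV : B = c *: V by apply/eqP; rewrite -subr_eq0; apply/eqP/hsdot_eq0/eqP.
  have {}Vu : V \is unitarymx.
    move: d3; rewrite mulf_eq0 expf_eq0 (gt_eqF c0) subr_eq0 => /eqP d3.
    exact/Vu/esym.
  have BB : B *m B ^t* = (c ^+ 2)%:M.
    rewrite BV linearZ map_mxZ /= cr -scalemxAl -scalemxAr (unitarymxP Vu).
    by rewrite scalerA scale_scalar_mx mulr1 expr2.
  split; last split.
  - apply/plainE; rewrite (sigma0_scalar m0 (ltW c0) BB).
    (* B is real, so the real part in [d4] is the inner product itself. *)
    have BJ : hsdot B (allones m n) = hsdot (allones m n) B.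
      rewrite hsdotE hsdot_allones; apply: eq_bigr => i _.
      by apply: eq_bigr => j _; rewrite mxE rmorph1 mulr1 Br.
    move: d4; rewrite mulf_eq0 mulf_eq0 (gt_eqF c0) (gt_eqF t0).
    rewrite subr_eq0 => /eqP d4.
    have : 2 * hsdot (allones m n) B = 2 * (c * (sqrtC m%:R * sqrtC n%:R)).
      rewrite [RHS]mulrCA d4 mulr_natl mulr2n -{1}BJ.
      by rewrite BV hsdotZl hsdotZr cr mulrDr.
    by move/(mulfI two0) ->; rewrite mulfK // mulf_neq0 ?gt_eqF.
  - move=> i j i' j'; suff Bn k l : `|B k l| = t by rewrite !Bn.
    move/eqP: d2; rewrite sumB => d2.
    have d2k := psumr_eq0P (fun k' _ => sumB0 k') d2 (i := k) isT.
    have /eqP := psumr_eq0P (fun l' _ => Bt2 k l') d2k (i := l) isT.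
    rewrite subr_eq0 eq_sym eqrXn2 ?normr_ge0 ?ltW //; exact: eqP.
  - by move=> i i' ii'; rewrite dotmx_row BB mxE (negPf ii').
(* Converse: at an entry where A equals t, B equals 2t - t = t, which fixes the common modulus. *)
have Bn i j : `|B i j| = t.
  by rewrite (Bmod i j i0 j0) BE Aij0 mulr_natl mulr2n addrK ger0_norm // ltW.
have BB : B *m B ^t* = (c ^+ 2)%:M.
  apply/matrixP=> i j; rewrite -dotmx_row [RHS]mxE.
  case: eqVneq => [<-|ij]; last by rewrite Borth.
  rewrite dotmx_row mxE (eq_bigr (fun=> t ^+ 2)) => [|k _].
    by rewrite sumr_const card_ord c2 mulr_natr.
  by rewrite !mxE -normCK Bn.
(* B B^* = c^2 makes the largest singular value c, and plainness turns this into the value of <J,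
   B>. *)
have BJ : hsdot (allones m n) B = c * (sqrtC m%:R * sqrtC n%:R).
  move: Bplain; rewrite (sigma0_scalar m0 (ltW c0) BB) => ->.
  by rewrite divfK // mulf_neq0 ?gt_eqF.
have cVr : (c^-1)^* = c^-1 by rewrite fmorphV /= cr.
have cn0 : c != 0 by rewrite gt_eqF.
have Wu : c^-1 *: B \is unitarymx.
  apply/unitarymxP; rewrite linearZ map_mxZ /= cVr -scalemxAl -scalemxAr BB.
  by rewrite scalerA scale_scalar_mx -expr2 -exprMn mulVf // expr1n.
have := schatten1_ge A Wu.
have HB : hsdot B B = c ^+ 2 * m%:R.
  by rewrite /hsdot BB mxtrace_scalar mulr_natr.
have BJ' : hsdot B (allones m n) = c * (sqrtC m%:R * sqrtC n%:R).
  rewrite hsdotC BJ; apply/CrealP/ger0_real.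
  by rewrite !mulr_ge0 ?ltW.
have AE : A = 2^-1 *: (B + t *: allones m n)
  by rewrite -ABt scalerA mulVf ?scale1r.
(* With V = B / c, 2 Re <A, V> = (||B||^2 + t <J, B>) / c, where ||B||^2 = c^2 m and t sqrt(mn) = c
   sqrt m. *)
have -> : hsdot A (c^-1 *: B) + hsdot (c^-1 *: B) A =
    c * (m%:R + sqrtC m%:R).
  rewrite {1 2}AE !(hsdotDl, hsdotDr, hsdotZl, hsdotZr) cVr fmorphV.
  rewrite rmorph_nat tr BJ BJ' HB /c; field.
  by rewrite (gt_eqF t0) (gt_eqF sn0).
move=> lower.
apply: (mulfI (x := 4)); first by rewrite pnatr_eq0.
(* The upper bound is the nonnegativity of the defect; the other inequality is [lower]. *)
rewrite targetE; apply/le_anti/andP; split.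
  rewrite -subr_ge0 -(pmulr_rge0 _ c0) defect.
  exact: addr_ge0 (addr_ge0 (addr_ge0 h1 h2) h3) h4.
rewrite -mulrA.
have -> : 4 * schatten1 A = 2 * (2 * schatten1 A) by ring.
by rewrite ler_pM2l ?ltr0n.
Qed.

End HilbertSchmidt.

(** * Passage to the max norm *)

Lemma mx_norm_ge (K : numDomainType) m n (A : 'M[K]_(m, n)) i j :
  `|A i j| <= mx_norm A.
Proof.
have : mx_norm A <= mx_norm A by [].
rewrite {1}mx_normE mx_normE [_ <= _%:num]num_le.
by move/bigmax_leP => [_ /(_ (i, j) isT)].
Qed.

(** The norm equality is homogeneous in A while 2A - J is not, so J is scaled by |A|_oo in the
    general form; the form with J itself is the normalization |A|_oo = 1. *)
Theorem theorem20 (R : realType) (m n : nat) (A : 'M[R[i]]_(m, n)) :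
  (1 <= m)%N -> (m <= n)%N ->
  (forall i j, 0 <= A i j) ->
  (schatten1 A = (m%:R + sqrtC m%:R) * sqrtC n%:R / 2 * mx_norm A <->
     plain (2 *: A - mx_norm A *: allones m n) /\
     Had (2 *: A - mx_norm A *: allones m n))
  /\
  (mx_norm A = 1 ->
   (schatten1 A = (m%:R + sqrtC m%:R) * sqrtC n%:R / 2 * mx_norm A <->
      plain (2 *: A - allones m n) /\ Had (2 *: A - allones m n))).
Proof.
move=> m0 mn A0; have n0 := leq_trans m0 mn.
have main : schatten1 A = (m%:R + sqrtC m%:R) * sqrtC n%:R / 2 * mx_norm A <->
    plain (2 *: A - mx_norm A *: allones m n) /\
    Had (2 *: A - mx_norm A *: allones m n).
  (* If |A|_oo = 0 then A = 0 and both sides hold: the zero matrix is plain, belongs to Had and has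
     Schatten norm 0. *)
  have [t0|t0] := eqVneq (mx_norm A) 0.
    rewrite t0 mulr0 (mx_norm_eq0 t0) scaler0 scale0r subrr.
    have zz : (0 : 'M[R[i]]_(m, n)) *m 0 ^t* = (0 ^+ 2)%:M.
      by rewrite mul0mx expr0n raddf0.
    split=> _; last first.
      rewrite /schatten1 /sigma (singular_values_scalar (lexx 0) zz).
      by apply: big1 => k _; rewrite nth_nseq if_same.
    split; last by split=> *; rewrite ?mxE // dotmx_row mul0mx mxE.
    apply/plainE; rewrite (sigma0_scalar m0 (lexx 0) zz).
    by rewrite /hsdot trmx0 map_mx0 mulmx0 mxtrace0 mul0r.
  have [[i j] /= Aij] := mx_norm_neq0 t0.
  apply: schatten1_extremal => //.
  - by rewrite lt_neqAle eq_sym t0 Aij normr_ge0.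
  - by move=> k l; rewrite A0 -[A k l]ger0_norm // mx_norm_ge.
  - by exists i, j; rewrite Aij ger0_norm.
split; first exact: main.
by move=> t1; move: main; rewrite t1 scale1r.
Qed.
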